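(* Let $\mathcal{H}$ be the union graph $\bigsqcup_{n\ge0} G_n$ of the nested sequence of finite graphs $(G_n)_{n\ge 0}$ defined recursively as follows: $G_0$ is a single vertex, called $0$; given $G_{n-1}$, the graph $H_n$ is obtained by taking the disjoint union of $G_{n-1}$ with a new 4-cycle $C_4$ and identifying one vertex of the 4-cycle with the vertex $0$ of $G_{n-1}$ (the identified vertex is again called $0$); and $G_n$ is the hive graph of $H_n$ of height $l_n=2n+5$, with hive vertex denoted $v_n$. Then $\mathcal{H}$ is locally finite and locally constructible, but is not a weak cop win.
   Context: Graphs are undirected, loopless and connected. We write $x\sim x'$ if $x$ and $x'$ are adjacent or equal. Hive graph: for a finite graph $H$, the hive graph of $H$ of height $n$ has vertex set $(H\times\{0,1,\ldots,n\})\cup\{v\}$, where $v$ is a special vertex, the hive vertex. The vertex $v$ is adjacent exactly to all vertices of the form $(x,n)$; distinct vertices $(x,i)$ and $(x',i')$ are adjacent if and only if $x\sim x'$ and $|i-i'|\le1$. The graph $H$ is identified with the 0-level of its hive graph via $x\mapsto(x,0)$. With this identification $G_{n-1}\subset H_n\subset G_n$ as induced subgraphs, and the vertex $0$ is a vertex of every $G_n$. Union graph: for a nested sequence $(G_n)_{n\ge0}$ of finite graphs ($G_n$ a fixed induced subgraph of $G_m$ for all $m\ge n$), the union graph $\bigsqcup G_n$ has vertices the pairs $(n,x)$ with $n\ge 0$ an integer and $x\in G_n$, and distinct vertices $(n,x)$, $(n',x')$ are adjacent if and only if $|n-n'|\le1$ and $x\sim x'$ (in $G_{\max(n,n')}$).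 A vertex $u$ dominates a vertex $v\neq u$ in a graph if the set consisting of $v$ and all neighbours of $v$ is contained in the set consisting of $u$ and all neighbours of $u$. A finite graph $H$ is constructible if there is an ordering $x_1,\ldots,x_n$ of its vertices such that for every $k>1$, in the induced graph $H[x_1,\ldots,x_k]$ the vertex $x_k$ is dominated by $x_i$ for some $i<k$. A graph $G$ is locally constructible if for every finite set of vertices $V$ there is a finite set of vertices $U$ containing $V$ such that $G[U]$ is constructible. A graph is locally finite if every vertex has finite degree. Cops and robbers: on a graph $G$ the cop picks a starting vertex, then the robber picks a starting vertex; then they move alternately, with the cop moving first. At each turn the player moves to an adjacent vertex or does not move. The cop catches the robber if he lands on the robber's vertex. $G$ is a weak cop win if there is a strategy for the cop that guarantees that either the cop catches the robber or, for every vertex, the robber visits that vertex only finitely often. *)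

(* Defs.v *)
From HB Require Import structures.
From mathcomp Require Import all_boot finmap.

Set Implicit Arguments.
Unset Strict Implicit.
Unset Printing Implicit Defensive.

(* Connectedness is not part of the structure: the induced subgraphs used in
   the definition of constructibility are graphs too. *)
Record graph (T : choiceType) := Graph {
  adj :> rel T;
  adj_sym : symmetric adj;
  adj_irr : irreflexive adj
}.

Definition sim (T : choiceType) (g : graph T) (x y : T) : bool :=
  (x == y) || g x y.

Lemma sim_sym (T : choiceType) (g : graph T) : symmetric (sim g).
Proof. by move=> x y; rewrite /sim eq_sym adj_sym. Qed.

(* |i - j| <= 1 *)
Definition near_nat (i j : nat) : bool := (i <= j.+1) && (j <= i.+1).

Lemma near_nat_sym : symmetric near_nat.
Proof. by move=> i j; rewrite /near_nat andbC. Qed.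

Section Induced.
Variables (T : choiceType) (g : graph T) (U : {pred T}).

Definition induced_rel : rel {x : T | x \in U} :=
  fun x y => g (val x) (val y).

Lemma induced_sym : symmetric induced_rel.
Proof. by move=> x y; apply: adj_sym. Qed.

Lemma induced_irr : irreflexive induced_rel.
Proof. by move=> x; apply: adj_irr. Qed.

Definition induced : graph {x : T | x \in U} := Graph induced_sym induced_irr.
End Induced.

Definition dominates (T : choiceType) (g : graph T) (u v : T) : Prop :=
  u != v /\ forall w, sim g v w -> sim g u w.

Definition dominates_in (T : choiceType) (g : graph T) (U : {pred T})
    (u v : T) : Prop :=
  exists u' v' : {x : T | x \in U},
    [/\ val u' = u, val v' = v & dominates (induced g U) u' v'].

(* The ordering is the bijection x, indexed from 0; its existence forces the
   graph to be finite. *)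
Definition constructible (T : choiceType) (g : graph T) : Prop :=
  exists (n : nat) (x : 'I_n -> T),
    bijective x /\
    forall k : 'I_n, 0 < k ->
      exists i : 'I_n, i < k /\
        dominates_in g [pred y | [exists j : 'I_n, (j <= k) && (x j == y)]]
          (x i) (x k).

Definition locally_constructible (T : choiceType) (g : graph T) : Prop :=
  forall V : {fset T}, exists U : {fset T},
    (V `<=` U)%fset /\ constructible (induced g (mem U)).

Definition locally_finite (T : choiceType) (g : graph T) : Prop :=
  forall x : T, exists N : {fset T}, forall y : T, (y \in N) = g x y.

(* A strategy sends the list of the robber's positions so far to the cop's
   next position: strategy [::] is his starting vertex, and cop_pos k.+1 is his
   answer to the robber's positions r 0, ..., r k. *)
Definition cop_pos (T : Type) (strategy : seq T -> T) (r : nat -> T) (k : nat)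
  : T := strategy (mkseq r k).

Definition weak_cop_win (T : choiceType) (g : graph T) : Prop :=
  exists strategy : seq T -> T,
    forall r : nat -> T, (forall k, sim g (r k) (r k.+1)) ->
      let c := cop_pos strategy r in
      (forall k, sim g (c k) (c k.+1)) /\
      ((exists k, c k.+1 = r k) \/
       (forall x : T, exists N : nat, forall k, N <= k -> r k <> x)).

Section Hive.
Variables (T : finType) (g : graph T) (n : nat).

(* None is the hive vertex. *)
Definition hive_vertex : finType := option (T * 'I_n.+1)%type.

Definition hive_base (x : T) : hive_vertex := Some (x, ord0).

Definition hive_rel : rel hive_vertex := fun u v =>
  match u, v with
  | None, None => false
  | None, Some (_, i) | Some (_, i), None => i == ord_max
  | Some (x, i), Some (y, j) =>
      [&& (x, i) != (y, j), sim g x y & near_nat i j]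
  end.

Lemma hive_sym : symmetric hive_rel.
Proof.
by move=> [[x i]|] [[y j]|] //=; rewrite eq_sym sim_sym near_nat_sym.
Qed.

Lemma hive_irr : irreflexive hive_rel.
Proof. by move=> [[x i]|] //=; rewrite eqxx. Qed.

Definition hive : graph hive_vertex := Graph hive_sym hive_irr.
End Hive.

(* Disjoint union of g and h with the vertex b of h identified with the
   vertex a of g. *)
Section Glue.
Variables (T S : finType) (g : graph T) (h : graph S) (a : T) (b : S).

Definition glue_vertex : finType := (T + {y : S | y != b})%type.

Definition glue_rel : rel glue_vertex := fun u v =>
  match u, v with
  | inl x, inl y => g x y
  | inr x, inr y => h (val x) (val y)
  | inl x, inr y | inr y, inl x => (x == a) && h b (val y)
  end.

Lemma glue_sym : symmetric glue_rel.
Proof. by move=> [x|x] [y|y] //=; apply: adj_sym. Qed.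

Lemma glue_irr : irreflexive glue_rel.
Proof. by move=> [x|x] /=; apply: adj_irr. Qed.

Definition glue : graph glue_vertex := Graph glue_sym glue_irr.
End Glue.

Definition C4_rel : rel 'I_4 := fun i j => (ordS i == j) || (ordS j == i).

Lemma C4_sym : symmetric C4_rel.
Proof. by move=> i j; apply: orbC. Qed.

Lemma C4_irr : irreflexive C4_rel.
Proof.
by move=> i; rewrite /C4_rel orbb -val_eqE; case: i => [[|[|[|[|i]]]] lti].
Qed.

Definition C4 : graph 'I_4 := Graph C4_sym C4_irr.

(* Only consecutive inclusions are recorded; the others are composites. *)
Record nested_seq := NestedSeq {
  ns_vertex : nat -> finType;
  ns_graph : forall n, graph (ns_vertex n);
  ns_incl : forall n, ns_vertex n -> ns_vertex n.+1;
  ns_incl_inj : forall n, injective (@ns_incl n);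
  ns_incl_adj : forall n (x y : ns_vertex n),
    ns_graph n.+1 (ns_incl x) (ns_incl y) = ns_graph n x y
}.

Section UnionGraph.
Variable s : nested_seq.

Definition union_vertex : choiceType := {n : nat & ns_vertex s n}.

Definition union_up (u : union_vertex) : union_vertex :=
  Tagged (ns_vertex s) (ns_incl (tagged u)).

(* u and v lie in the same G_n and are adjacent or equal there. *)
Definition level_sim (u v : union_vertex) : bool :=
  (tag u == tag v) && sim (ns_graph s (tag u)) (tagged u) (tagged_as u v).

(* The three cases are n = n', n' = n + 1 and n = n' + 1 for u = (n, x) and
   v = (n', x'). *)
Definition union_rel : rel union_vertex := fun u v =>
  (u != v) &&
  [|| level_sim u v, level_sim (union_up u) v | level_sim u (union_up v)].

Lemma level_sim_sym : symmetric level_sim.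
Proof.
move=> [n x] [m y]; rewrite /level_sim /= (eq_sym m).
by case: (n =P m) => //= nm; case: m / nm y => y; rewrite !tagged_asE sim_sym.
Qed.

Lemma union_sym : symmetric union_rel.
Proof.
move=> u v; rewrite /union_rel eq_sym; congr andb.
rewrite (level_sim_sym v u) (level_sim_sym v (union_up u)).
by rewrite (level_sim_sym (union_up v) u); congr orb; apply: orbC.
Qed.

Lemma union_irr : irreflexive union_rel.
Proof. by move=> u; rewrite /union_rel eqxx. Qed.

Definition union_graph : graph union_vertex := Graph union_sym union_irr.
End UnionGraph.

Definition height (n : nat) : nat := 2 * n + 5.

Fixpoint G_vertex (n : nat) : finType :=
  match n with
  | 0 => unit
  | m.+1 => hive_vertex (glue_vertex (G_vertex m) (@ord0 3)) (height m.+1)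
  end.

(* The vertex set of H_{m+1}. *)
Definition H_vertex (m : nat) : finType := glue_vertex (G_vertex m) (@ord0 3).

Definition G_incl (n : nat) (x : G_vertex n) : G_vertex n.+1 :=
  hive_base (height n.+1) (inl x : H_vertex n).

Fixpoint zero (n : nat) : G_vertex n :=
  match n return G_vertex n with
  | 0 => tt
  | m.+1 => G_incl (zero m)
  end.

Definition K1 : graph unit :=
  @Graph unit (fun _ _ => false) (fun _ _ => erefl) (fun _ => erefl).

Fixpoint G (n : nat) : graph (G_vertex n) :=
  match n return graph (G_vertex n) with
  | 0 => K1
  | m.+1 => hive (glue (G m) C4 (zero m) ord0) (height m.+1)
  end.

Lemma G_incl_inj (n : nat) : injective (@G_incl n).
Proof. by move=> x y []. Qed.

Lemma G_incl_adj (n : nat) (x y : G_vertex n) :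
  G n.+1 (G_incl x) (G_incl y) = G n x y.
Proof.
rewrite /= /sim /= andbT; case: (x =P y) => [->|ne].
  by rewrite eqxx adj_irr.
have -> /= : ((inl x, ord0) != (inl y, ord0) :> H_vertex n * 'I_(height n.+1).+1).
  by apply/eqP=> -[/ne].
by case: eqP => // -[/ne].
Qed.

Definition G_seq : nested_seq := NestedSeq G_incl_inj G_incl_adj.

Definition calH : graph (union_vertex G_seq) := union_graph G_seq.

(* Main.v *)
Require Import Defs.
From mathcomp Require Import all_boot finmap zify.

(* Local constructibility: list the levels of the union graph downwards from
   level n, starting with G_n in the order v_n, then the hive from top to
   bottom; (k, x) with k < n is dominated by (k.+1, x), and a hive vertex by the
   one above it.

   Robber's strategy: fold G_k minus the hive vertices v_m with m >= n onto the
   4-cycle attached in H_n.  The robber stays on that cycle, antipodal to the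
   folded cop, until the cop stands over some v_m with m >= n.  The cop then
   has altitude 2m + 6 in the m-th hive, and this altitude changes by at most 1
   per move unless he goes over a later hive vertex.  So the robber has time to
   run back to (0, 0) and out again to the antipode of 0 on the cycle of H_{m+1},
   while the folded cop is still at 0; if meanwhile the cop goes over a later
   hive vertex, the robber restarts this run with the larger m.  Either he stays
   on a single cycle from some time on, or he visits (0, 0) infinitely often. *)

Set Implicit Arguments.
Unset Strict Implicit.
Unset Printing Implicit Defensive.

(** * Constructibility from a rank function *)

Section Rank.
Variables (T : choiceType) (g : graph T) (U : {fset T}) (rk : T -> nat).

(** Order [U] by rank: the smaller rank puts [w] before [u], and since every [z] of rank at most
    [rk u] is tested, ties may be broken arbitrarily. *)
Lemma constructible_of_rank :
  {in U &, forall u v, rk u = 0 -> rk v = 0 -> u = v} ->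
  {in U, forall u, 0 < rk u -> exists2 w, w \in U & rk w < rk u /\
    {in U, forall z, rk z <= rk u -> sim g u z -> sim g w z}} ->
  constructible (induced g (mem U)).
Proof.
move=> rk0 dom.
pose ler := [rel u v | rk u <= rk v].
pose s := sort ler (enum_fset U).
have memS u : (u \in s) = (u \in U) by rewrite mem_sort.
have uniqS : uniq s by rewrite sort_uniq fset_uniq.
have ler_tr : transitive ler by move=> y x z; apply: leq_trans.
have sortS : sorted ler s by apply: sort_sorted => x y; apply: leq_total.
pose x (i : 'I_(size s)) : {u | u \in mem U} :=
  exist _ (tnth (in_tuple s) i) (etrans (esym (memS _)) (mem_tnth i (in_tuple s))).
have xE i u0 : val (x i) = nth u0 s i by rewrite /= (tnth_nth u0).
have idxP u : u \in U -> index u s < size s by rewrite index_mem memS.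
have x_idx u (Uu : u \in U) (lt_us : index u s < size s) :
    val (x (Ordinal lt_us)) = u.
  by rewrite (xE _ u) nth_index // memS.
exists (size s), x; split.
  exists (fun u => Ordinal (idxP _ (valP u))) => [i | u].
    apply: val_inj => /=; rewrite (tnth_nth (val (x i))) /=.
    by rewrite index_uniq.
  by apply: val_inj; apply: x_idx; apply: valP.
move=> k k_gt0; set u := val (x k).
have Uu : u \in U := valP (x k).
have lt0s : 0 < size s := leq_ltn_trans (leq0n k) (ltn_ord k).
have rk_le (i j : 'I_(size s)) : i <= j -> rk (val (x i)) <= rk (val (x j)).
  move=> le_ij; rewrite !(xE _ u).
  by apply: (sorted_leq_nth ler_tr _ u sortS); rewrite ?inE //= => y; apply: leqnn.
(* The first vertex has least rank, so rank 0 at a later position would give two vertices of rank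
   0. *)
have rku : 0 < rk u.
  rewrite lt0n; apply/eqP => rku0.
  have := rk_le (Ordinal lt0s) k (leq0n k); rewrite -/u rku0 leqn0 => /eqP rk00.
  have := rk0 _ _ (valP (x (Ordinal lt0s))) Uu rk00 rku0.
  rewrite /u !(xE _ u) => /eqP; rewrite nth_uniq //= => /eqP k0.
  by rewrite -k0 in k_gt0.
have [w Uw [lt_wu domw]] := dom u Uu rku.
pose i := Ordinal (idxP w Uw); have xi : val (x i) = w := x_idx _ Uw _.
have lt_ik : i < k.
  rewrite ltnNge; apply/negP => /rk_le; rewrite xi -/u leqNgt lt_wu //.
exists i; split=> //.
set P := [pred y | _].
have Pi : x i \in P.
  by rewrite !inE; apply/existsP; exists i; rewrite eqxx ltnW.
have Pk : x k \in P by rewrite !inE; apply/existsP; exists k; rewrite eqxx leqnn.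
exists (exist _ (x i) Pi), (exist _ (x k) Pk); split=> //; split.
  apply/eqP => /(congr1 (fun y => val (val y))) /= E.
  by move: lt_wu; rewrite /u /= -E -[X in rk X < _]xi /= ltnn.
move=> [z Pz]; rewrite /sim -!val_eqE /= /induced_rel /=.
have /existsP[j /andP[le_jk /eqP xj]] := Pz.
have := domw (val z) (valP z).
rewrite /sim -xj => /(_ (rk_le _ _ le_jk)).
by rewrite -xi.
Qed.
End Rank.

(** * Levels of a union graph *)

Section Levels.
Variable s : nested_seq.

Definition levels_le (n : nat) : {fset union_vertex s} :=
  [fset u in [seq Tagged (ns_vertex s) x | k <- iota 0 n.+1, x <- enum (ns_vertex s k)]]%fset.

Definition level (u : union_vertex s) : nat := tag u.

Lemma level_up u : level (union_up u) = (level u).+1.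
Proof. by []. Qed.

Lemma in_levels_le n u : (u \in levels_le n) = (level u <= n).
Proof.
rewrite in_fset; apply/allpairsPdep/idP => [[k [x [+ _ ->]]]|].
  by rewrite mem_iota.
by case: u => k x le_kn; exists k, x; rewrite mem_iota mem_enum.
Qed.

Lemma level_sim_tag (u v : union_vertex s) : level_sim u v -> level u = level v.
Proof. by case/andP=> /eqP. Qed.

Lemma union_locally_finite : locally_finite (union_graph s).
Proof.
move=> u; exists [fset v in levels_le (level u).+1 | union_graph s u v]%fset => v.
rewrite !(in_levels_le, inE) andb_idl // => /andP[_].
by case/or3P=> /level_sim_tag; rewrite ?level_up; lia.
Qed.

Lemma union_simE (u v : union_vertex s) :
  sim (union_graph s) u v =
  [|| level_sim u v, level_sim (union_up u) v | level_sim u (union_up v)].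
Proof.
rewrite /sim /= /union_rel; case: eqP => //= ->.
by case: v => n x; rewrite /level_sim /= !eqxx tagged_asE /sim eqxx.
Qed.

Lemma level_simE n (x y : ns_vertex s n) :
  level_sim (Tagged (ns_vertex s) x) (Tagged (ns_vertex s) y) = sim (ns_graph s n) x y.
Proof. by rewrite /level_sim eqxx /= tagged_asE. Qed.

Lemma level_simP (u v : union_vertex s) : level_sim u v ->
  exists n (x y : ns_vertex s n),
    [/\ u = Tagged (ns_vertex s) x, v = Tagged (ns_vertex s) y &
        sim (ns_graph s n) x y].
Proof.
case: u v => n x [m y] H; have /= nm : n = m := level_sim_tag H.
by case: m / nm y H => y; rewrite level_simE; exists n, x, y.
Qed.

Lemma level_sim_up (u v : union_vertex s) :
  level_sim u v -> level_sim (union_up u) (union_up v).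
Proof.
case/level_simP=> n [x [y [-> -> xy]]]; rewrite level_simE.
by rewrite /sim ns_incl_adj (inj_eq (@ns_incl_inj s n)).
Qed.

Lemma union_sim_same_level n (x y : ns_vertex s n) :
  sim (union_graph s) (Tagged (ns_vertex s) x) (Tagged (ns_vertex s) y) =
  sim (ns_graph s n) x y.
Proof.
rewrite union_simE level_simE; case: sim => //=.
by apply/negP => /orP[] /level_sim_tag; rewrite level_up /level /=; lia.
Qed.

(** Lower levels come after all of level [n], in descending order. When $(k,x)$ is placed, level
    $k-1$ is still absent, and its neighbours on levels $k$ and $k+1$ are adjacent or equal to
    $(k+1,x)$. *)
Lemma levels_constructible n (rk : ns_vertex s n -> nat) (K : nat) :
  (forall x, rk x <= K) ->
  (forall x y, rk x = 0 -> rk y = 0 -> x = y) ->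
  (forall x, 0 < rk x -> exists2 w, rk w < rk x &
    forall z, rk z <= rk x -> sim (ns_graph s n) x z -> sim (ns_graph s n) w z) ->
  constructible (induced (union_graph s) (mem (levels_le n))).
Proof.
move=> rkK rk0 dom.
pose rkU (u : union_vertex s) :=
  if n =P level u is ReflectT e then rk (ecast k (ns_vertex s k) (esym e) (tagged u))
  else K + (n - level u).
have rkE x : rkU (Tagged (ns_vertex s) x) = rk x.
  by rewrite /rkU /=; case: eqP => // e; rewrite eq_axiomK.
have rkN u : n != level u -> rkU u = K + (n - level u).
  by rewrite /rkU; case: eqP.
have onE u : n = level u -> exists x, u = Tagged (ns_vertex s) (x : ns_vertex s n).
  by case: u => k x /= e; subst k; exists x.
apply: (@constructible_of_rank _ _ _ rkU) => [u v|u].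
  rewrite !in_levels_le => le_u le_v.
  have lift w : level w <= n -> rkU w = 0 -> n = level w.
    by move=> le_w; case: (n =P level w) => // /eqP ne; rewrite rkN //; lia.
  move=> /[dup] /(lift u le_u) /onE[x ->] + /[dup] /(lift v le_v) /onE[y ->].
  by rewrite !rkE => /rk0 r0 /r0 ->.
rewrite in_levels_le => le_u; case: (n =P level u) => [/onE[x ->]|/eqP ne].
  rewrite rkE => /dom[w lt_wx domw].
  exists (Tagged (ns_vertex s) w); rewrite ?in_levels_le // rkE; split=> // z.
  rewrite in_levels_le => le_z.
  case: (n =P level z) => [/onE[y ->]|/eqP ne].
    rewrite rkE => le_yx.
    by rewrite !union_sim_same_level; apply: domw.
  by have := rkK x; rewrite rkN //; move: ne; lia.
move=> _; exists (union_up u); first by rewrite in_levels_le level_up; lia.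
have rk_le (v : union_vertex s) : level v <= n -> level u < level v -> rkU v < rkU u.
  move=> le_v lt_uv; rewrite (rkN u) //.
  case: (n =P level v) => [/onE[x ->]|/eqP ?]; last by rewrite rkN //; lia.
  by rewrite rkE; have := rkK x; lia.
split=> [|z]; first by apply: rk_le; rewrite level_up; lia.
rewrite in_levels_le => le_z le_zu; rewrite !union_simE.
case/or3P=> [/level_sim_up -> | -> // | /level_sim_tag uz]; first by rewrite !orbT.
have {}uz : level u = (level z).+1 := uz.
suff: rkU u < rkU z by rewrite ltnNge le_zu.
by rewrite !rkN //; lia.
Qed.
End Levels.

(** * Apex, folding and altitude *)

(* The index j such that x lies over v_j, and 0 if there is none: the indices of
   hive vertices start at 1. *)
Fixpoint apex (k : nat) : G_vertex k -> nat :=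
  match k return G_vertex k -> nat with
  | 0 => fun=> 0
  | l.+1 => fun v => match v with
      | None => l.+1
      | Some (inl x, _) => apex x
      | Some (inr _, _) => 0
      end
  end.

(* The folding onto the 4-cycle of H_n; the value at v_k is junk for k >= n, but
   such points are recognised by n <= apex x. *)
Fixpoint fold (n k : nat) : G_vertex k -> 'I_4 :=
  match k return G_vertex k -> 'I_4 with
  | 0 => fun=> ord0
  | l.+1 => fun v => match v with
      | None => ord0
      | Some (inl x, _) => fold n x
      | Some (inr y, _) => if l.+1 == n then val y else ord0
      end
  end.

(* The height in the m-th hive, with v_m at (height m).+1 and everything else
   folded to 0; the value at v_k is junk for k > m. *)
Fixpoint altitude (m k : nat) : G_vertex k -> nat :=
  match k return G_vertex k -> nat with
  | 0 => fun=> 0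
  | l.+1 => fun v => match v with
      | None => if m <= l.+1 then (height m).+1 else 0
      | Some (inl x, i) => if l.+1 == m then val i else altitude m x
      | Some (inr _, i) => if l.+1 == m then val i else 0
      end
  end.

Definition hive_rank (k : nat) : G_vertex k -> nat :=
  match k return G_vertex k -> nat with
  | 0 => fun=> 0
  | l.+1 => fun v => if v is Some (_, i) then (height l.+1).+1 - i else 0
  end.

Lemma fold_lt n k (x : G_vertex k) : k < n -> fold n x = ord0.
Proof.
elim: k x => //= k IH [[[x|y] i]|] // lt_kn; first by apply: IH; lia.
by case: eqP => //; lia.
Qed.

Lemma altitude_lt m k (x : G_vertex k) : k < m -> altitude m x = 0.
Proof.
elim: k x => //= k IH [[[x|y] i]|] // lt_kn; case: ifP => //; try lia.
by move=> _; apply: IH; lia.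
Qed.

Lemma apex_le k (x : G_vertex k) : apex x <= k.
Proof. by elim: k x => //= k IH [[[x|y] i]|] //; apply: leqW. Qed.

Lemma altitude_incl m k (x : G_vertex k) : altitude m (G_incl x) = altitude m x.
Proof. by rewrite /=; case: eqP => // <-; rewrite altitude_lt. Qed.

Lemma fold_zero n k : fold n (zero k) = ord0.
Proof. by elim: k. Qed.

Lemma altitude_zero n k : altitude n (zero k) = 0.
Proof. by elim: k => // k IH; rewrite altitude_incl. Qed.

Lemma apex_zero k : apex (zero k) = 0.
Proof. by elim: k. Qed.

Lemma altitude_apex k (x : G_vertex k) : 0 < apex x -> altitude (apex x) x = (height (apex x)).+1.
Proof.
elim: k x => //= k IH [[[x|y] i]|] //=; last by rewrite leqnn.
by case: eqP => [E|_]; [have := apex_le x; lia | exact: IH].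
Qed.

(** A nonzero [fold m.+1 x] places [x] over the cycle attached in $H_{m+1}$, where [altitude m]
    vanishes. *)
Lemma fold_next k m (x : G_vertex k) : 0 < altitude m x -> fold m.+1 x = ord0.
Proof.
elim: k x => //= k IH [[[x|y] i]|] //=; case: eqP => [E|_] //.
- by move=> _; apply: fold_lt; lia.
- exact: IH.
- by move=> _; case: eqP => // ?; exfalso; lia.
Qed.

Lemma sim_hive (T : finType) (g : graph T) l (u v : hive_vertex T l) :
  sim (hive g l) u v =
  match u, v with
  | None, None => true
  | None, Some (_, i) | Some (_, i), None => i == ord_max
  | Some (x, i), Some (y, j) => sim g x y && near_nat i j
  end.
Proof.
rewrite /sim; case: u v => [[x i]|] [[y j]|] //=.
rewrite (inj_eq (@Some_inj _)); case: eqP => [[-> ->]|//].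
by rewrite /sim eqxx /near_nat !leqnSn.
Qed.

Lemma sim_glue (T S : finType) (g : graph T) (h : graph S) a b (u v : glue_vertex T b) :
  sim (glue g h a b) u v =
  match u, v with
  | inl x, inl y => sim g x y
  | inr x, inr y => sim h (val x) (val y)
  | inl x, inr y | inr y, inl x => (x == a) && h b (val y)
  end.
Proof. by rewrite /sim; case: u v => [x|x] [y|y]. Qed.

(** The bounds exclude the $v_m$ with $m\ge n$, whose neighbours fold onto the whole cycle. Other
    edges project downwards, and gluing edges start at 0, which folds to [ord0]. *)
Lemma fold_sim n k (x y : G_vertex k) : apex x < n -> apex y < n ->
  sim (G k) x y -> sim C4 (fold n x) (fold n y).
Proof.
elim: k x y => [|k IH] //.
have [lt_kn|le_nk] := ltnP k.+1 n; first by move=> x y; rewrite !fold_lt.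
move=> [[a i]|] [[b j]|]; rewrite sim_hive /=; try lia.
move=> + + /andP[+ _]; rewrite sim_glue.
case: a b => [x|x] [y|y]; first exact: IH.
- move=> _ _ /andP[/eqP -> adj]; rewrite fold_zero.
  by case: ifP => // _; rewrite /sim adj orbT.
- move=> _ _ /andP[/eqP -> adj]; rewrite fold_zero.
  by case: ifP => // _; rewrite sim_sym /sim adj orbT.
- by case: ifP.
Qed.

(** The bounds exclude the later hive vertices; $v_m$ sits one above the top of its hive, and later
    cycles are glued at 0, of altitude 0. *)
Lemma altitude_sim m k (x y : G_vertex k) : apex x <= m -> apex y <= m ->
  sim (G k) x y -> altitude m x <= (altitude m y).+1.
Proof.
elim: k x y => [|k IH] //.
have [lt_km|le_mk] := ltnP k.+1 m; first by move=> x y; rewrite !altitude_lt.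
move=> [[a i]|] [[b j]|]; rewrite sim_hive /= ?le_mk.
- move=> + + /andP[+ /andP[le_ij le_ji]]; rewrite sim_glue.
  case: a b => [x|x] [y|y]; case: ifP => // _; first exact: IH.
  by move=> _ _ /andP[/eqP ->]; rewrite altitude_zero.
- move=> _ le_km /eqP ->; have -> : m = k.+1 by lia.
  by rewrite eqxx; case: a => _ /=; lia.
- move=> le_km _ /eqP ->; have -> : m = k.+1 by lia.
  by rewrite eqxx; case: b => _ /=; lia.
- by [].
Qed.

(* For j > 0, the 4-cycle attached at 0 in H_j, with cyc j ord0 the vertex 0;
   for j = 0, constantly the vertex 0. *)
Definition cyc (j : nat) (p : 'I_4) : G_vertex j :=
  match j return G_vertex j with
  | 0 => tt
  | l.+1 => hive_base (height l.+1)
      (if insub p is Some y then inr y else inl (zero l) : H_vertex l)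
  end.

Lemma cyc0 j : cyc j ord0 = zero j.
Proof. by case: j => //= j; rewrite insubF. Qed.

Lemma apex_cyc j p : apex (cyc j p) = 0.
Proof. by case: j => //= j; case: insubP => //= *; rewrite apex_zero. Qed.

Lemma altitude_cyc m j p : altitude m (cyc j p) = 0.
Proof. by case: j => //= j; case: insubP => /= *; rewrite ?altitude_zero ?if_same. Qed.

Lemma fold_cyc n p : 0 < n -> fold n (cyc n p) = p.
Proof.
case: n => //= n _; case: insubP => [y _ <- /=|/negPn/eqP ->]; first by rewrite eqxx.
by rewrite fold_zero.
Qed.

Lemma sim_cyc j p q : sim C4 p q -> sim (G j) (cyc j p) (cyc j q).
Proof.
case: j => // j; rewrite sim_hive /= andbT sim_glue.
case: insubP => [y ny <-|/negPn/eqP ->]; case: insubP => [z nz <-|/negPn/eqP ->] //.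
- by rewrite eqxx sim_sym /sim eq_sym (negPf (valP y)).
- by rewrite eqxx /sim eq_sym (negPf (valP z)).
- by move=> _; rewrite /sim eqxx.
Qed.

(** * Local constructibility of [calH] *)

Lemma G_levels_constructible n :
  constructible (induced calH (mem (levels_le G_seq n))).
Proof.
apply: (@levels_constructible G_seq n (@hive_rank n) (height n).+1); case: n => [|n] /=.
- by [].
- by move=> [[y i]|] //; apply: leq_subr.
- by move=> [] [].
- by move=> [[y [i lt_i]]|] [[z [j lt_j]]|] //=; lia.
- by [].
move=> [[y [i lt_ih]]|] //= _.
(* Only vertices of height at least [i] and the hive vertex have rank at most that of height [i], so
   the vertex directly above dominates; at the top, the hive vertex does. *)
have [lt_i|ge_i] := ltnP i (height n.+1).
  exists (Some (y, Ordinal (n := (height n.+1).+1) (m := i.+1) lt_i)) => /=; first lia.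
  move=> [[z j]|] le_z; rewrite !sim_hive -?val_eqE /=.
    by rewrite /near_nat => /and3P[-> _] /=; have := ltn_ord j; move: le_z => /=; lia.
  by lia.
exists None => /=; first lia.
move=> [[z j]|] //= le_z _; rewrite sim_hive -val_eqE /=; have := ltn_ord j; lia.
Qed.

Lemma calH_locally_constructible : locally_constructible calH.
Proof.
move=> V; exists (levels_le G_seq (\max_(u <- V) level u)); split.
  by apply/fsubsetP => u Vu; rewrite in_levels_le; apply: leq_bigmax_seq.
exact: G_levels_constructible.
Qed.

(** * Coordinates on the union graph *)

Section CoordinatesOnUnion.
Implicit Types u v : union_vertex G_seq.

Definition apexU u : nat := apex (tagged u : G_vertex (tag u)).
Definition foldU n u : 'I_4 := fold n (tagged u : G_vertex (tag u)).
Definition altitudeU m u : nat := altitude m (tagged u : G_vertex (tag u)).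

Lemma altitudeU_up m u : altitudeU m (union_up u) = altitudeU m u.
Proof. exact: altitude_incl. Qed.

(** One inclusion brings vertices of consecutive levels into a single $G_k$, and it preserves all
    three coordinates. *)
Lemma calH_sim_lift u v : sim calH u v ->
  exists k (x y : G_vertex k),
    [/\ sim (G k) x y, apexU u = apex x /\ apexU v = apex y,
        (forall n, foldU n u = fold n x /\ foldU n v = fold n y) &
        (forall m, altitudeU m u = altitude m x /\ altitudeU m v = altitude m y)].
Proof.
rewrite union_simE => /or3P[] /level_simP[k [x [y [Eu Ev xy]]]]; exists k, x, y; split=> //.
- by rewrite Eu Ev.
- by rewrite Eu Ev.
- by rewrite Eu Ev.
- by rewrite -[apexU u]/(apexU (union_up u)) Eu Ev.
- by move=> n; rewrite -[foldU n u]/(foldU n (union_up u)) Eu Ev.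
- by move=> m; rewrite -[altitudeU m u]altitudeU_up Eu Ev.
- by rewrite -[apexU v]/(apexU (union_up v)) Eu Ev.
- by move=> n; rewrite -[foldU n v]/(foldU n (union_up v)) Eu Ev.
- by move=> m; rewrite -[altitudeU m v]altitudeU_up Eu Ev.
Qed.

Lemma foldU_sim n u v : apexU u < n -> apexU v < n -> sim calH u v ->
  sim C4 (foldU n u) (foldU n v).
Proof.
move=> au av /calH_sim_lift[k [x [y [xy [ax ay] /(_ n)[-> ->] _]]]].
by apply: fold_sim; rewrite -?ax -?ay.
Qed.

Lemma altitudeU_sim m u v : apexU u <= m -> apexU v <= m -> sim calH u v ->
  altitudeU m u <= (altitudeU m v).+1.
Proof.
move=> au av /calH_sim_lift[k [x [y [xy [ax ay] _ /(_ m)[-> ->]]]]].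
by apply: altitude_sim; rewrite -?ax -?ay.
Qed.

End CoordinatesOnUnion.

(** * The robber's strategy and its invariant *)

Definition cycU (jp : nat * 'I_4) : union_vertex G_seq :=
  Tagged G_vertex (cyc jp.1 jp.2).

(** The way back to $(0,0)$: around the cycle, then down the copies of 0. It rests at its end
    because [0.-1] is 0. *)
Definition inward (jp : nat * 'I_4) : nat * 'I_4 :=
  if jp.2 == ord0 then (jp.1.-1, ord0) else (jp.1, ord_pred jp.2).

Definition antipode (p : 'I_4) : 'I_4 := ordS (ordS p).

Lemma sim_ordS (p : 'I_4) : sim C4 p (ordS p).
Proof. by rewrite /sim /= /C4_rel eqxx orbT. Qed.

Lemma antipode_sim p q : sim C4 p q -> sim C4 (antipode p) (antipode q).
Proof.
by rewrite /sim /= /C4_rel /antipode !(inj_eq (@ordS_inj _)).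
Qed.

Lemma antipode_far p : ~~ sim C4 p (antipode p).
Proof.
rewrite /sim /= /C4_rel /antipode -!val_eqE /=.
by case: p => [[|[|[|[|p]]]] ltp].
Qed.

Lemma cycU_sim j p q : sim C4 p q -> sim calH (cycU (j, p)) (cycU (j, q)).
Proof. by rewrite union_sim_same_level; apply: sim_cyc. Qed.

Lemma cycU_sim_up j : sim calH (cycU (j, ord0)) (cycU (j.+1, ord0)).
Proof.
rewrite union_simE; apply/or3P; apply: Or32.
have E : cyc j.+1 ord0 = G_incl (cyc j ord0) by rewrite !cyc0.
by rewrite {2}/cycU E (@level_simE G_seq j.+1) /sim eqxx.
Qed.

Lemma cycU_sim_inward jp : sim calH (cycU jp) (cycU (inward jp)).
Proof.
case: jp => j p; rewrite /inward /=; case: eqP => [->|_].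
  case: j => [|j]; first by rewrite /sim eqxx.
  by rewrite sim_sym; apply: cycU_sim_up.
rewrite cycU_sim // sim_sym -[X in sim C4 _ X](ord_predK p); exact: sim_ordS.
Qed.

Inductive mode := Evade | Retreat | Advance.

(** The robber stands at [cycU place] and stays on, or runs for, the cycle with index [target]. *)
Record state := State { mode_of : mode; target : nat; place : nat * 'I_4 }.

Definition step (c : union_vertex G_seq) (s : state) : state :=
  let: State m n (j, p) := s in
  if n <= apexU c then State Retreat (apexU c).+1 (inward (j, p)) else
  match m with
  | Evade => let q := antipode (foldU n c) in
      (* The test makes the move legal for every [c], so [step_sim] needs no invariant; under [inv]
         and a legal cop move it succeeds. *)
      State Evade n (j, if sim C4 p q then q else p)
  | Retreat => if j == 0 then State Advance n (1, ord0) else State Retreat n (inward (j, p))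
  | Advance => if (p == ord0) && (j < n) then State Advance n (j.+1, ord0)
      else State (if p == ord0 then Advance else Evade) n (j, ordS p)
  end.

(* In the last two cases the left-hand side is the number of moves left before
   reaching the antipode on the target cycle; the path back to 0 is taken by
   decreasing p, which may cost 3 moves instead of 1. *)
Definition inv (c : union_vertex G_seq) (s : state) : Prop :=
  let: State m n (j, p) := s in
  [/\ 0 < n, apexU c < n, j <= n &
  match m with
  | Evade => j = n /\ p = antipode (foldU n c)
  | Retreat => j + p + n + 2 < altitudeU n.-1 c
  | Advance => [/\ p < 2, (p == ord0) || (j == n) & (n - j) + (2 - p) < altitudeU n.-1 c]
  end].

Lemma inward_lt (jp : nat * 'I_4) : 0 < jp.1 + jp.2 -> (inward jp).1 + (inward jp).2 < jp.1 + jp.2.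
Proof.
case: jp => j [p ltp]; rewrite /inward -val_eqE /=; case: eqP => /=; lia.
Qed.

Lemma step_sim c s : sim calH (cycU (place s)) (cycU (place (step c s))).
Proof.
case: s => m n [j p]; rewrite /step.
case: ifP => _; first exact: cycU_sim_inward.
case: m => /=.
- by apply: cycU_sim; case: ifP => //; rewrite /sim eqxx.
- case: eqP => [->|_]; last exact: cycU_sim_inward.
  exact: (cycU_sim_up 0).
- case: ifP => [/andP[/eqP -> _]|_]; first exact: cycU_sim_up.
  by apply: cycU_sim; apply: sim_ordS.
Qed.

Lemma step_inv c c' s : sim calH c c' -> inv c s -> inv c' (step c' s).
Proof.
case: s => m n [j p] cc' [n_gt0 lt_cn le_jn] Hm; rewrite /step.
have [le_nc|lt_c'n] := leqP n (apexU c').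
  case E: (inward (j, p)) => [j' p'] /=; rewrite ltnS.
  have -> : altitudeU (apexU c') c' = (height (apexU c')).+1.
    by apply: altitude_apex; apply: leq_trans le_nc.
  (* Let $m$ be the new apex. From $j\le n\le m$ and $p\le3$, one inward move leaves $j'+p'\le m+2$;
     the way out adds $(m+1)+2$, giving $2m+5$, just below the altitude $2m+6$. The [maxn 1] covers
     a robber resting at $(0,0)$. *)
  have [le_j le_jp] : j' <= j /\ j' + p' < maxn 1 (j + p).
    case: p E {Hm} => p ltp; rewrite /inward -val_eqE /=.
    by case: eqP => /= [p0|p0] [<- <-] /=; lia.
  by have := ltn_ord p; rewrite /height; split=> //; lia.
have alt_c : altitudeU n.-1 c <= (altitudeU n.-1 c').+1 by apply: altitudeU_sim => //; lia.
case: m Hm => /=.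
- move=> [-> pE]; have := foldU_sim lt_cn lt_c'n cc' => /antipode_sim.
  by rewrite pE => ->.
- case: eqP => [->|j0] H; first by split=> //; split=> //=; lia.
  case: p H => p ltp /= H; rewrite /inward -val_eqE /=.
  by case: eqP => /= p0; split=> //; lia.
move=> [lt_p2 pj H]; case: ifP => [/andP[/eqP p0 lt_jn]|].
  by rewrite p0 /= in H *; split=> //; split=> //; lia.
case: eqP pj => /= [p0 _ /negbT|p0 /eqP jn _].
  rewrite -leqNgt => le_nj; split=> //; rewrite p0 /= in H *.
  by split=> //=; lia.
have p1 : p = inord 1.
  by apply: val_inj; rewrite /= inordK //; move/eqP: p0; rewrite -val_eqE /=; lia.
(* Positive altitude means that the cop is still folded to 0, so the robber's step from 1 to 2 lands
   on the antipode. *)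
have : 0 < altitudeU n.-1 c' by lia.
move/fold_next; rewrite prednK // => f0.
by split=> //; split=> //; rewrite /foldU f0 p1; apply: val_inj; rewrite /= inordK.
Qed.

(** Capture would bring the cop to altitude 0 from altitude at most 1, too low for a run under
    [inv]; while evading, his folded image cannot reach the antipode in one move. *)
Lemma inv_uncaught c c' s : sim calH c c' -> inv c s -> c' <> cycU (place s).
Proof.
case: s => m n [j p] cc' [n_gt0 lt_cn le_jn] Hm /= Ec'.
have lt_c'n : apexU c' < n by rewrite Ec' /apexU /= apex_cyc.
have alt_c : altitudeU n.-1 c <= 1.
  have : altitudeU n.-1 c' = 0 by rewrite Ec' /altitudeU /= altitude_cyc.
  by move=> alt0; rewrite -[1]/(0.+1) -alt0; apply: altitudeU_sim => //; lia.
case: m Hm; [move=> [jn pE] | lia | move=> [? _]; lia].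
have := foldU_sim lt_cn lt_c'n cc'.
rewrite Ec' {2}/foldU /= jn fold_cyc // pE.
by apply/negP/antipode_far.
Qed.

(** * The play against a fixed cop strategy *)

Section Play.
Variable strategy : seq (union_vertex G_seq) -> union_vertex G_seq.

(** The target exceeds the level of the cop's first vertex, which is therefore folded to 0 and has
    apex below the target. *)
Let start : state :=
  let n := (level (strategy [::])).+1 in State Evade n (n, antipode ord0).

Fixpoint play (k : nat) : seq (union_vertex G_seq) * state :=
  if k is l.+1 then
    let: (h, s) := play l in
    let h' := rcons h (cycU (place s)) in (h', step (strategy h') s)
  else ([::], start).

Definition robber_state k : state := (play k).2.
Definition robber k : union_vertex G_seq := cycU (place (robber_state k)).
Let cop := cop_pos strategy robber.

Lemma play_history k : (play k).1 = mkseq robber k.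
Proof.
elim: k => // k IH; rewrite mkseqS -IH /= /robber /robber_state.
by case: (play k).
Qed.

Lemma robber_stateS k : robber_state k.+1 = step (cop k.+1) (robber_state k).
Proof.
rewrite /cop /cop_pos mkseqS -play_history /robber /robber_state /=.
by case: (play k).
Qed.

Lemma robber_sim k : sim calH (robber k) (robber k.+1).
Proof. by rewrite /robber robber_stateS; apply: step_sim. Qed.

Hypothesis cop_sim : forall k, sim calH (cop k) (cop k.+1).

Lemma robber_inv k : inv (cop k) (robber_state k).
Proof.
elim: k => [|k IH]; last by rewrite robber_stateS; apply: step_inv IH.
rewrite /robber_state /start /= /cop /cop_pos /=; split=> //.
  by rewrite ltnS; apply: apex_le.
by rewrite /foldU fold_lt.
Qed.

Lemma robber_uncaught k : cop k.+1 <> robber k.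
Proof. exact: inv_uncaught (cop_sim k) (robber_inv k). Qed.

Hypothesis finite_visits : forall x, exists N, forall k, N <= k -> robber k <> x.

(** In [Retreat] with [j > 0], restarted or not, the next state is again [Retreat] with smaller
    [j + p], so the robber would reach $(0,0)$ once more. *)
Lemma not_retreat : exists N, forall k, N <= k -> mode_of (robber_state k) <> Retreat.
Proof.
have [N HN] := finite_visits (cycU (0, ord0)); exists N => k.
have [d] := ubnP ((place (robber_state k)).1 + (place (robber_state k)).2).
elim: d k => // d IH k lt_d le_Nk mdk; have := HN k le_Nk; rewrite /robber.
have := IH k.+1 _ (leqW le_Nk); rewrite robber_stateS.
case E: (robber_state k) lt_d mdk => [m n [[|j] p]] //=.
rewrite ltnS => le_d -> IHk _; apply: IHk; last by case: ifP.
have := @inward_lt (j.+1, p) isT; case: ifP => _ /=; lia.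
Qed.

Lemma evade_forever : exists n N, forall k, N <= k ->
  exists p, robber_state k = State Evade n (n, p).
Proof.
have [N HN] := not_retreat.
(* A cop over some $v_m$ with $m$ at least the target would force a [Retreat]; hence the target is
   constant from now on. *)
have lt_apex k : N <= k -> apexU (cop k.+1) < target (robber_state k).
  move=> le_Nk; have := HN k.+1 (leqW le_Nk); rewrite robber_stateS ltnNge.
  by case: (robber_state k) => m n [j p] /=; case: ifP.
have [K le_NK mdK] : exists2 K, N <= K & mode_of (robber_state K) = Evade.
  (* This measure drops at each [Advance] move, so [Evade] is eventually reached. *)
  pose left_to_go s := (target s - (place s).1) + (2 - (place s).2).
  suff reach d k : N <= k -> left_to_go (robber_state k) < d ->
      exists2 K, N <= K & mode_of (robber_state K) = Evade.
    exact: (reach _ N (leqnn N) (ltnSn _)).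
  elim: d k => // d IH k le_Nk.
  rewrite /left_to_go in IH * => lt_d.
  have := IH k.+1 (leqW le_Nk); have := HN k le_Nk; have := lt_apex k le_Nk.
  have := robber_inv k; rewrite robber_stateS.
  case E: (robber_state k) lt_d => [[] n [j p]] //= lt_d; first by exists k; rewrite ?E.
  case=> _ _ le_jn [lt_p2 pj _] lt_an _; rewrite (leqNgt n) lt_an /=.
  case: ifP => [/andP[/eqP p0 lt_jn]|]; first by apply; move: lt_d; rewrite p0 /=; lia.
  case: eqP => [p0 _|p0 _ _]; first by apply; move: lt_d; rewrite p0 /=; lia.
  by exists k.+1; [lia | rewrite robber_stateS E /= (leqNgt n) lt_an (introF eqP p0)].
exists (target (robber_state K)), K; elim=> [|k IH] le_Kk.
  have K0 : K = 0 by lia.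
  have := robber_inv 0; rewrite K0 in mdK *; case: (robber_state 0) mdK => m n [j p] /= ->.
  by case=> _ _ _ [-> _]; exists p.
move: le_Kk; rewrite leq_eqVlt => /predU1P[<-|].
  have := robber_inv K; case: (robber_state K) mdK => m n [j p] /= ->.
  by case=> _ _ _ [-> _]; exists p.
rewrite ltnS => le_Kk; have [p E] := IH le_Kk.
have := lt_apex k (leq_trans le_NK le_Kk).
rewrite robber_stateS E /= => lt_an; rewrite leqNgt lt_an /=.
by eexists.
Qed.

(** The robber ends up on one cycle of four vertices; past the largest of their four visit bounds he
    has nowhere to stand. *)
Lemma finite_visits_absurd : False.
Proof.
have [n [N HN]] := evade_forever.
have [M HM] : exists M : 'I_4 -> nat, forall p k, M p <= k -> robber k <> cycU (n, p).
  by apply: (fin_all_exists (fun p => finite_visits (cycU (n, p)))).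
pose K := maxn N (\max_p M p).
have [p E] := HN K (leq_maxl _ _).
apply: (HM p K); last by rewrite /robber E.
by rewrite leq_max orbC (leq_bigmax p).
Qed.
End Play.

Theorem theorem8 :
  locally_finite calH /\ locally_constructible calH /\ ~ weak_cop_win calH.
Proof.
split; first exact: union_locally_finite.
split; first exact: calH_locally_constructible.
move=> [strategy win].
have [cop_sim] := win _ (robber_sim strategy); case=> [[k]|].
  exact: robber_uncaught cop_sim k.
exact: finite_visits_absurd.
Qed.
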